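(* Let $\omega_1,\omega_2\in\mathbb C$ be nonzero with $\omega_1/\omega_2\notin\mathbb R$, let $\Lambda=\{a\omega_1+b\omega_2: a,b\in\mathbb Z\}$, and let $\wp$ be the Weierstrass $\wp$-function of $\Lambda$. Then the Laurent expansion of $\wp$ at $z=0$ is $$\wp(z)=\frac{1}{z^2}+\sum_{k=1}^\infty (2k+1)E_{2k+2}\,z^{2k},\qquad\text{where}\quad E_k=\sum_{\omega\in\Lambda\setminus\{0\}}\frac{1}{\omega^k}.$$
   Context: The Weierstrass $\wp$-function of $\Lambda$ is the meromorphic function $\wp(z)=\frac{1}{z^2}+\sum_{\omega\in\Lambda\setminus\{0\}}\left(\frac{1}{(z+\omega)^2}-\frac{1}{\omega^2}\right)$ on $\mathbb C$. The numbers $E_k$ are called the Eisenstein series of $\Lambda$. *)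

(* Defs.v *)
From Stdlib Require Import Reals List ClassicalEpsilon.
From Coquelicot Require Import Coquelicot.
Local Open Scope C_scope.

Definition lattice (w1 w2 : C) : C -> Prop :=
  fun w => exists a b : Z, w = RtoC (IZR a) * w1 + RtoC (IZR b) * w2.

Definition punctured (L : C -> Prop) : C -> Prop := fun w => L w /\ w <> 0.

(* Filter of the finite subsets of [D], directed by inclusion. A finite subset
   is represented by a repetition-free list of its elements. *)
Definition finite_subsets (D : C -> Prop) : (list C -> Prop) -> Prop :=
  fun P => exists F0 : list C,
    NoDup F0 /\ (forall w, In w F0 -> D w) /\
    forall F : list C,
      NoDup F -> (forall w, In w F -> D w) -> incl F0 F -> P F.

Definition list_sum (f : C -> C) (F : list C) : C :=
  fold_right Cplus 0 (map f F).

(* A sum over [D] carries no order of summation: it is the limit of the finite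
   partial sums along [finite_subsets D], which exists in C exactly when the
   sum converges absolutely. *)
Definition is_sum (D : C -> Prop) (f : C -> C) (l : C) : Prop :=
  filterlim (list_sum f) (finite_subsets D) (locally l).

Definition ex_sum (D : C -> Prop) (f : C -> C) : Prop :=
  exists l : C, is_sum D f l.

(* Meaningful only under [ex_sum D f]. *)
Definition Csum (D : C -> Prop) (f : C -> C) : C :=
  epsilon (inhabits (RtoC 0)) (is_sum D f).

Definition eisenstein (L : C -> Prop) (k : nat) : C :=
  Csum (punctured L) (fun w => 1 / w ^ k).

Definition weierstrass_term (z w : C) : C := 1 / (z + w) ^ 2 - 1 / w ^ 2.

(* Meaningful for [z] outside [L]. *)
Definition weierstrass_p (L : C -> Prop) (z : C) : C :=
  1 / z ^ 2 + Csum (punctured L) (weierstrass_term z).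

(* Main.v *)
(* The lattice is symmetric, so the Weierstrass term may be replaced by its
   average over [w] and [-w], which expands as a power series in [(z / w)^2]:
   the odd powers cancel before any summation. The remainder after [N] terms
   has an explicit closed form; since [|z| <= q |w|] for one [q < 1] valid at
   all nonzero lattice points, it is at most [c q^N / |w|^3]. As the sum of
   [1 / |w|^3] over the lattice is finite, summing over [w] and letting [N]
   grow exchanges the two summations without a general Fubini theorem. *)
From Stdlib Require Import Reals List Permutation ClassicalEpsilon Lra Lia.
From Coquelicot Require Import Coquelicot.
Require Import Defs.
Local Open Scope C_scope.

(** * Sums over finite lists *)

Definition rsum {A : Type} (h : A -> R) (l : list A) : R :=
  fold_right Rplus 0%R (map h l).

Lemma rsum_app {A : Type} (h : A -> R) (l l' : list A) :
  rsum h (l ++ l') = (rsum h l + rsum h l')%R.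
Proof.
  unfold rsum; induction l as [|x l IH]; simpl; [|rewrite IH]; ring.
Qed.

Lemma rsum_map {A B : Type} (h : B -> R) (g : A -> B) (l : list A) :
  rsum h (map g l) = rsum (fun x => h (g x)) l.
Proof. unfold rsum; now rewrite map_map. Qed.

Lemma rsum_permutation {A : Type} (h : A -> R) (l l' : list A) :
  Permutation l l' -> rsum h l = rsum h l'.
Proof.
  unfold rsum; induction 1; simpl; try lra; congruence.
Qed.

Lemma rsum_ge0 {A : Type} (h : A -> R) (l : list A) :
  (forall x, In x l -> (0 <= h x)%R) -> (0 <= rsum h l)%R.
Proof.
  unfold rsum; induction l as [|x l IH]; simpl; intros H; [lra|].
  assert (H1 := H x (or_introl eq_refl)).
  assert (H2 := IH (fun y Hy => H y (or_intror Hy))); lra.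
Qed.

Lemma rsum_le {A : Type} (h g : A -> R) (l : list A) :
  (forall x, In x l -> (h x <= g x)%R) -> (rsum h l <= rsum g l)%R.
Proof.
  unfold rsum; induction l as [|x l IH]; simpl; intros H; [lra|].
  assert (H1 := H x (or_introl eq_refl)).
  assert (H2 := IH (fun y Hy => H y (or_intror Hy))); lra.
Qed.

Lemma rsum_scal {A : Type} (c : R) (h : A -> R) (l : list A) :
  rsum (fun x => c * h x)%R l = (c * rsum h l)%R.
Proof.
  unfold rsum; induction l as [|x l IH]; simpl; [|rewrite IH]; ring.
Qed.

Lemma rsum_list_prod {A B : Type} (u : A -> R) (v : B -> R) l l' :
  rsum (fun p => u (fst p) * v (snd p))%R (list_prod l l')
  = (rsum u l * rsum v l')%R.
Proof.
  induction l as [|x l IH]; simpl; [unfold rsum; simpl; ring|].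
  rewrite rsum_app, IH, rsum_map; simpl.
  rewrite rsum_scal; unfold rsum; simpl; ring.
Qed.

(** Passing to a larger finite set amounts to appending a remainder [r], so a difference of partial
    sums becomes a sum over [r]. Only the smaller list must be free of repetitions. *)
Lemma incl_permutation_app {A : Type} (l l' : list A) :
  NoDup l -> incl l l' -> exists r, Permutation l' (l ++ r).
Proof.
  revert l'; induction l as [|x l IH]; intros l' Hl Hi.
  - now exists l'.
  - destruct (in_split x l' (Hi x (or_introl eq_refl))) as (l1 & l2 & ->).
    inversion Hl as [|? ? Hx Hl']; subst.
    destruct (IH (l1 ++ l2)) as [r Hr]; [easy| |].
    + intros y Hy.
      assert (Hy' := Hi y (or_intror Hy)).
      apply in_app_iff in Hy'; apply in_app_iff.
      destruct Hy' as [?|[<-|?]]; tauto.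
    + exists r; simpl; rewrite <- Hr; symmetry; apply Permutation_middle.
Qed.

Lemma rsum_incl_le {A : Type} (h : A -> R) (l l' : list A) :
  (forall x, (0 <= h x)%R) -> NoDup l -> incl l l' ->
  (rsum h l <= rsum h l')%R.
Proof.
  intros H Hl Hi; destruct (incl_permutation_app l l' Hl Hi) as [r Hr].
  rewrite (rsum_permutation h l' _ Hr), rsum_app.
  assert (H' := rsum_ge0 h r (fun x _ => H x)); lra.
Qed.

Lemma list_sum_app (f : C -> C) (l l' : list C) :
  list_sum f (l ++ l') = list_sum f l + list_sum f l'.
Proof.
  unfold list_sum; induction l as [|x l IH]; simpl; [|rewrite IH]; ring.
Qed.

Lemma list_sum_permutation (f : C -> C) (l l' : list C) :
  Permutation l l' -> list_sum f l = list_sum f l'.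
Proof.
  unfold list_sum; induction 1; simpl; [easy|congruence|ring|congruence].
Qed.

Lemma Cmod_list_sum (f : C -> C) (l : list C) :
  (Cmod (list_sum f l) <= rsum (fun w => Cmod (f w)) l)%R.
Proof.
  unfold list_sum, rsum; induction l as [|x l IH]; simpl.
  - rewrite Cmod_0; lra.
  - eapply Rle_trans; [apply Cmod_triangle|lra].
Qed.

(** * Unordered sums *)

(** Two thresholds are merged by taking their union, and repetitions are removed by decidable
    equality on [C]. Properness holds because a threshold contains itself. *)
#[local] Instance finite_subsets_proper (D : C -> Prop) :
  ProperFilter (finite_subsets D).
Proof.
  split.
  - intros P (F0 & H0 & H1 & H); exists F0; apply H; auto; apply incl_refl.
  - split.
    + exists nil; split; [constructor|split; [easy|trivial]].
    + intros P Q (F & HF & HFD & HP) (G & HG & HGD & HQ).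
      exists (nodup Ceq_dec (F ++ G)); split; [apply NoDup_nodup|split].
      * intros w Hw; apply nodup_In, in_app_iff in Hw; destruct Hw; auto.
      * intros H HH HHD Hi; split; [apply HP|apply HQ]; auto;
          intros w Hw; apply Hi, nodup_In, in_app_iff; auto.
    + intros P Q HPQ (F & HF & HFD & HP); exists F; auto.
Qed.

Lemma is_sum_unique (D : C -> Prop) (f : C -> C) (l l' : C) :
  is_sum D f l -> is_sum D f l' -> l = l'.
Proof.
  apply (@filterlim_locally_unique _ C_AbsRing C_NormedModule).
  typeclasses eauto.
Qed.

Lemma Csum_correct (D : C -> Prop) (f : C -> C) :
  ex_sum D f -> is_sum D f (Csum D f).
Proof. apply epsilon_spec. Qed.

Lemma is_sum_Cmod (D : C -> Prop) (f : C -> C) (l : C) (eps : R) :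
  is_sum D f l -> (0 < eps)%R ->
  finite_subsets D (fun F => (Cmod (list_sum f F - l) < eps)%R).
Proof.
  intros H He.
  apply (H (fun y => Cmod (y - l) < eps)%R).
  apply (@locally_le_locally_norm C_AbsRing C_NormedModule).
  exists (mkposreal eps He); intros y Hy; exact Hy.
Qed.

Lemma is_sum_ext (D : C -> Prop) (f g : C -> C) (l : C) :
  (forall w, D w -> f w = g w) -> is_sum D f l -> is_sum D g l.
Proof.
  intros Hfg H P HP; destruct (H P HP) as (F0 & H0 & H1 & H2).
  exists F0; split; [easy|split; [easy|]]; intros F HF HFD Hi.
  replace (list_sum g F) with (list_sum f F); [now apply H2|].
  unfold list_sum; f_equal; apply map_ext_in; auto.
Qed.

Lemma is_sum_plus (D : C -> Prop) (f g : C -> C) (l m : C) :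
  is_sum D f l -> is_sum D g m -> is_sum D (fun w => f w + g w) (l + m).
Proof.
  intros Hf Hg; unfold is_sum.
  apply filterlim_ext with (fun F => list_sum f F + list_sum g F).
  - intros F; unfold list_sum; induction F as [|x F IH]; simpl;
      [|rewrite <- IH]; ring.
  - apply (filterlim_comp_2 _ _ Cplus Hf Hg).
    apply (@filterlim_plus C_AbsRing C_NormedModule).
Qed.

Lemma is_sum_scal (D : C -> Prop) (c : C) (f : C -> C) (l : C) :
  is_sum D f l -> is_sum D (fun w => c * f w) (c * l).
Proof.
  intros Hf; unfold is_sum.
  apply filterlim_ext with (fun F => c * list_sum f F).
  - intros F; unfold list_sum; induction F as [|x F IH]; simpl;
      [|rewrite <- IH]; ring.
  - apply (filterlim_comp _ _ _ _ _ _ _ _ Hf).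
    apply (@filterlim_scal_r C_AbsRing C_NormedModule).
Qed.

Lemma is_sum_sum_n (D : C -> Prop) (f : nat -> C -> C) (l : nat -> C) N :
  (forall n, is_sum D (f n) (l n)) ->
  is_sum D (fun w => sum_n (fun n => f n w) N) (sum_n l N).
Proof.
  intros H; induction N as [|N IH].
  - rewrite sum_O; eapply is_sum_ext; [|apply H].
    intros w _; now rewrite sum_O.
  - rewrite sum_Sn; eapply is_sum_ext; [|apply (is_sum_plus _ _ _ _ _ IH (H (S N)))].
    intros w _; now rewrite sum_Sn.
Qed.

(** Negation permutes [D], so it carries finite subsets to finite subsets and respects inclusion.
    The threshold for the new sum is the negated old one. *)
Lemma is_sum_opp_arg (D : C -> Prop) (f : C -> C) (l : C) :
  (forall w, D w -> D (- w)) -> is_sum D f l -> is_sum D (fun w => f (- w)) l.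
Proof.
  intros HD H P HP; destruct (H P HP) as (F0 & H0 & H1 & H2).
  assert (HI : FinFun.Injective Copp).
  { intros x y E; replace x with (- - x) by ring; rewrite E; ring. }
  exists (map Copp F0); split; [now apply FinFun.Injective_map_NoDup|split].
  - intros w Hw; apply in_map_iff in Hw; destruct Hw as (v & <- & Hv); auto.
  - intros F HF HFD Hi.
    replace (list_sum (fun w => f (- w)) F) with (list_sum f (map Copp F)).
    + apply H2.
      * now apply FinFun.Injective_map_NoDup.
      * intros w Hw; apply in_map_iff in Hw; destruct Hw as (v & <- & Hv); auto.
      * intros w Hw; replace w with (- - w) by ring.
        apply in_map, Hi, in_map, Hw.
    + unfold list_sum; now rewrite map_map.
Qed.

(** * Absolute convergence from bounded partial sums *)

Definition sums_bounded (D : C -> Prop) (h : C -> R) (M : R) : Prop :=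
  forall F, NoDup F -> (forall w, In w F -> D w) -> (rsum h F <= M)%R.

Lemma sums_bounded_dominated (D : C -> Prop) (g h : C -> R) (c M : R) :
  (0 <= c)%R -> sums_bounded D h M ->
  (forall w, D w -> (g w <= c * h w)%R) -> sums_bounded D g (c * M).
Proof.
  intros Hc Hh Hg F HF HFD.
  eapply Rle_trans; [apply rsum_le; intros w Hw; apply Hg, HFD, Hw|].
  rewrite rsum_scal; apply Rmult_le_compat_l; auto.
Qed.

(* Past a finite set whose sum of moduli is within [eps] of the supremum, the
   partial sums of [f] move by less than [eps]: they are Cauchy. *)
Lemma ex_sum_of_sums_bounded (D : C -> Prop) (f : C -> C) (M : R) :
  sums_bounded D (fun w => Cmod (f w)) M -> ex_sum D f.
Proof.
  intros HM.
  apply (@filterlim_locally_cauchy _ C_CompleteNormedModule _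
           (finite_subsets_proper D)).
  intros eps.
  destruct (completeness (fun x => exists F, NoDup F /\
     (forall w, In w F -> D w) /\ x = rsum (fun w => Cmod (f w)) F))
     as [s [Hs1 Hs2]].
  - exists M; intros x (F & HF & HFD & ->); now apply HM.
  - exists 0%R, nil; split; [constructor|split; easy].
  - assert (Hex : exists F0, NoDup F0 /\ (forall w, In w F0 -> D w) /\
       (s - eps / 2 < rsum (fun w => Cmod (f w)) F0)%R).
    { apply NNPP; intros Hn.
      assert (s <= s - eps / 2)%R.
      { apply Hs2; intros x (F & HF & HFD & ->).
        apply Rnot_lt_le; intros Hlt; apply Hn; now exists F. }
      assert (He := cond_pos eps); lra. }
    destruct Hex as (F0 & HF0 & HF0D & HF0s).
    exists (fun F => Cmod (list_sum f F - list_sum f F0) < eps / 2)%R; split.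
    + exists F0; split; [easy|split; [easy|]]; intros F HF HFD Hi.
      destruct (incl_permutation_app F0 F HF0 Hi) as [r Hr].
      rewrite (list_sum_permutation f F _ Hr), list_sum_app.
      replace (_ - _) with (list_sum f r) by ring.
      assert (HFs : (rsum (fun w => Cmod (f w)) F <= s)%R)
        by (apply Hs1; now exists F).
      rewrite (rsum_permutation _ F _ Hr), rsum_app in HFs.
      assert (H := Cmod_list_sum f r); lra.
    + intros F G HF HG; apply C_NormedModule_mixin_compat1.
      change (Cmod (list_sum f G - list_sum f F) < eps)%R.
      replace (list_sum f G - list_sum f F) with
        ((list_sum f G - list_sum f F0) + - (list_sum f F - list_sum f F0))
        by ring.
      eapply Rle_lt_trans; [apply Cmod_triangle|].
      rewrite Cmod_opp; lra.
Qed.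

Lemma ex_sum_dominated (D : C -> Prop) (f : C -> C) (h : C -> R) (c M : R) :
  (0 <= c)%R -> sums_bounded D h M ->
  (forall w, D w -> (Cmod (f w) <= c * h w)%R) -> ex_sum D f.
Proof.
  intros Hc Hh Hf; apply ex_sum_of_sums_bounded with (c * M)%R.
  now apply sums_bounded_dominated with h.
Qed.

Lemma Cmod_is_sum_le (D : C -> Prop) (f : C -> C) (l : C) (h : C -> R) (c M : R) :
  (0 <= c)%R -> sums_bounded D h M ->
  (forall w, D w -> (Cmod (f w) <= c * h w)%R) ->
  is_sum D f l -> (Cmod l <= c * M)%R.
Proof.
  (* If [Cmod l] exceeded [c * M], a partial sum closer to [l] than the gap [Cmod l - c * M] would
     itself have modulus above [c * M]. *)
  intros Hc Hh Hf Hl; apply Rnot_lt_le; intros Hlt.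
  destruct (is_sum_Cmod D f l (Cmod l - c * M) Hl) as (F & HF & HFD & H);
    [lra|].
  specialize (H F HF HFD (incl_refl F)).
  assert (H1 := sums_bounded_dominated D _ h c M Hc Hh Hf F HF HFD).
  assert (H2 := Cmod_list_sum f F); cbv beta in *.
  assert (H3 := Cmod_triangle (list_sum f F) (- (list_sum f F - l))).
  replace (list_sum f F + _) with l in H3 by ring.
  rewrite Cmod_opp in H3; lra.
Qed.

(** * Lattice estimates *)

Lemma Im_le_Cmod (c : C) : (Rabs (Im c) <= Cmod c)%R.
Proof. eapply Rle_trans; [apply Rmax_r|apply Rmax_Cmod]. Qed.

(** With [d] the imaginary part of [w1 * Cconj w2], multiplying [w = a w1 + b w2] by [Cconj w2] or
    [Cconj w1] and taking imaginary parts leaves [a d] or [- b d]. Each coordinate is therefore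
    controlled by [Cmod w], provided that [d] is nonzero. *)
Lemma lattice_coords_bound (w1 w2 : C) :
  w2 <> 0 -> (~ exists x : R, w1 / w2 = RtoC x) ->
  exists c : R, (0 < c)%R /\ forall a b : R,
    (c * Rabs a <= Cmod (RtoC a * w1 + RtoC b * w2))%R /\
    (c * Rabs b <= Cmod (RtoC a * w1 + RtoC b * w2))%R.
Proof.
  intros hw2 hw.
  set (d := Im (w1 * Cconj w2)).
  assert (Hd : d <> 0%R).
  (* The ratio [w1 / w2] equals [w1 * Cconj w2 / Cmod w2 ^ 2], which is real as soon as [d = 0]. *)
  { intros Hd; apply hw; exists (Re (w1 * Cconj w2) / Cmod w2 ^ 2)%R.
    assert (H2 := proj1 (Cmod_gt_0 w2) hw2).
    assert (E : w1 * Cconj w2 = RtoC (Re (w1 * Cconj w2))).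
    { unfold d in Hd; destruct (w1 * Cconj w2) as [x y]; simpl in *.
      unfold RtoC; now rewrite Hd. }
    rewrite RtoC_div, <- E, Cmod2_conj by (apply pow_nonzero; lra).
    field; split; [|easy].
    intros H; apply hw2, Cmod_eq_0; rewrite <- Cmod_conj, H; apply Cmod_0. }
  assert (Hs : (0 < Cmod w1 + Cmod w2)%R).
  { assert (H := Cmod_ge_0 w1); assert (H' := proj1 (Cmod_gt_0 w2) hw2); lra. }
  assert (Hd' := Rabs_pos_lt d Hd).
  (* The two coordinates give the constants [Rabs d / Cmod w2] and [Rabs d / Cmod w1]; the sum in
     the denominator serves both. *)
  exists (Rabs d / (Cmod w1 + Cmod w2))%R; split.
  { now apply Rdiv_lt_0_compat. }
  intros a b; set (w := RtoC a * w1 + RtoC b * w2).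
  assert (Hw := Cmod_ge_0 w).
  assert (Ha : (Rabs a * Rabs d <= Cmod w * Cmod w2)%R).
  { rewrite <- Rabs_mult, <- (Cmod_conj w2), <- Cmod_mult.
    replace (a * d)%R with (Im (w * Cconj w2)); [apply Im_le_Cmod|].
    unfold d, w; destruct w1, w2; simpl; ring. }
  assert (Hb : (Rabs b * Rabs d <= Cmod w * Cmod w1)%R).
  { rewrite <- Rabs_mult, <- (Cmod_conj w1), <- Cmod_mult, <- Rabs_Ropp.
    replace (- (b * d))%R with (Im (w * Cconj w1)); [apply Im_le_Cmod|].
    unfold d, w; destruct w1, w2; simpl; ring. }
  assert (H1 := Cmod_ge_0 w1); assert (H2 := Cmod_ge_0 w2).
  split; apply Rmult_le_reg_r with (Cmod w1 + Cmod w2)%R; auto;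
    field_simplify; nra.
Qed.

(** The integer 0 lies in both halves of [r], so some points are repeated. This is harmless: the box
    only encloses finite sets and bounds sums of nonnegative terms from above. The two halves reduce
    sums over [r] to sums over natural numbers. *)
Definition box (w1 w2 : C) (K : nat) : list C :=
  let r := map Z.of_nat (seq 0 (S K)) ++
           map (fun n => (- Z.of_nat n)%Z) (seq 0 (S K)) in
  map (fun p => RtoC (IZR (fst p)) * w1 + RtoC (IZR (snd p)) * w2)
    (list_prod r r).

Lemma in_box (w1 w2 : C) (K : nat) (a b : Z) :
  (Z.abs a <= Z.of_nat K)%Z -> (Z.abs b <= Z.of_nat K)%Z ->
  In (RtoC (IZR a) * w1 + RtoC (IZR b) * w2) (box w1 w2 K).
Proof.
  intros Ha Hb.
  assert (H : forall x, (Z.abs x <= Z.of_nat K)%Z ->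
    In x (map Z.of_nat (seq 0 (S K)) ++
          map (fun n => (- Z.of_nat n)%Z) (seq 0 (S K)))).
  { intros x Hx; apply in_app_iff.
    destruct (Z.le_ge_cases 0 x); [left|right]; apply in_map_iff;
      exists (Z.abs_nat x); rewrite in_seq; lia. }
  apply (in_map (fun p => RtoC (IZR (fst p)) * w1 + RtoC (IZR (snd p)) * w2)
           _ (a, b)).
  apply in_prod; auto.
Qed.

Lemma lattice_ball_in_box (w1 w2 : C) (B : R) :
  w2 <> 0 -> (~ exists x : R, w1 / w2 = RtoC x) ->
  exists K, forall w, lattice w1 w2 w -> (Cmod w <= B)%R -> In w (box w1 w2 K).
Proof.
  intros hw2 hw; destruct (lattice_coords_bound w1 w2 hw2 hw) as (c & Hc & H).
  exists (Z.to_nat (up (B / c))); intros w (a & b & ->) HB.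
  assert (HK : forall x : Z, (c * Rabs (IZR x) <= B)%R ->
    (Z.abs x <= Z.of_nat (Z.to_nat (up (B / c))))%Z).
  { intros x Hx; rewrite <- abs_IZR in Hx.
    assert (Hx' : (IZR (Z.abs x) <= B / c)%R).
    { apply Rmult_le_reg_l with c; auto; field_simplify; lra. }
    assert (Hu := archimed (B / c)).
    assert (IZR (Z.abs x) < IZR (up (B / c)))%R as Hl by lra.
    apply lt_IZR in Hl; lia. }
  destruct (H (IZR a) (IZR b)); apply in_box; apply HK; lra.
Qed.

Lemma Rabs_IZR_ge1 (x : Z) : (x <> 0)%Z -> (1 <= Rabs (IZR x))%R.
Proof. intros Hx; rewrite <- abs_IZR; apply IZR_le; lia. Qed.

(** A nonzero lattice point has a nonzero integer coordinate, of absolute value at least 1, so the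
    constant of the coordinate bound is itself a lower bound. *)
Lemma lattice_Cmod_ge (w1 w2 : C) :
  w2 <> 0 -> (~ exists x : R, w1 / w2 = RtoC x) ->
  exists r, (0 < r)%R /\
    forall w, punctured (lattice w1 w2) w -> (r <= Cmod w)%R.
Proof.
  intros hw2 hw; destruct (lattice_coords_bound w1 w2 hw2 hw) as (c & Hc & H).
  exists c; split; [easy|]; intros w [(a & b & ->) H0].
  destruct (H (IZR a) (IZR b)) as [Ha Hb].
  destruct (Z.eq_dec a 0) as [Ha0|Ha0]; [destruct (Z.eq_dec b 0) as [Hb0|Hb0]|].
  - exfalso; apply H0; subst; ring.
  - assert (H1 := Rabs_IZR_ge1 b Hb0); nra.
  - assert (H1 := Rabs_IZR_ge1 a Ha0); nra.
Qed.

(** Only finitely many lattice points satisfy [Cmod w <= 2 * Cmod z]. Over these the largest ratio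
    [Cmod z / Cmod w] is still below 1, and everywhere else the ratio is below 1/2. *)
Lemma lattice_ratio_lt_1 (w1 w2 z : C) :
  w2 <> 0 -> (~ exists x : R, w1 / w2 = RtoC x) ->
  (forall w, punctured (lattice w1 w2) w -> (Cmod z < Cmod w)%R) ->
  exists q, (0 <= q < 1)%R /\
    forall w, punctured (lattice w1 w2) w -> (Cmod z <= q * Cmod w)%R.
Proof.
  intros hw2 hw Hz.
  destruct (lattice_ball_in_box w1 w2 (2 * Cmod z) hw2 hw) as [K HK].
  (* The lower bound 1/2 on [q] is kept through the induction so that the same [q] covers the points
     outside the box. *)
  assert (Hl : forall l : list C, exists q, (1 / 2 <= q < 1)%R /\
    forall w, In w l -> punctured (lattice w1 w2) w ->
      (Cmod z <= q * Cmod w)%R).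
  { induction l as [|v l (q & Hq & IH)].
    - exists (1 / 2)%R; split; [lra|easy].
    - destruct (excluded_middle_informative (punctured (lattice w1 w2) v))
        as [Hv|Hv].
      + exists (Rmax q (Cmod z / Cmod v)).
        assert (Hzv := Hz v Hv); assert (Hz0 := Cmod_ge_0 z).
        split; [split|].
        * eapply Rle_trans; [apply Hq|apply Rmax_l].
        * apply Rmax_lub_lt; [easy|].
          apply Rmult_lt_reg_r with (Cmod v); [lra|]; field_simplify; lra.
        * intros w [<-|Hw] Hpw.
          -- apply Rle_trans with (Cmod z / Cmod v * Cmod v)%R.
             ++ right; field; lra.
             ++ apply Rmult_le_compat_r; [lra|apply Rmax_r].
          -- eapply Rle_trans; [apply IH; eauto|].
             apply Rmult_le_compat_r; [apply Cmod_ge_0|apply Rmax_l].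
      + exists q; split; [easy|]; intros w [<-|Hw] Hpw; [easy|auto]. }
  destruct (Hl (box w1 w2 K)) as (q & Hq & H).
  exists q; split; [lra|]; intros w Hw.
  destruct (Rle_lt_dec (Cmod w) (2 * Cmod z)) as [Hle|Hlt].
  - apply H; [apply HK; [apply Hw|easy]|easy].
  - assert (H0 := Cmod_ge_0 w); nra.
Qed.

(** * Summability of the inverse cubes *)

Lemma Rinv_ge0 (x : R) : (0 <= x)%R -> (0 <= / x)%R.
Proof.
  intros [Hx| <-]; [left; now apply Rinv_0_lt_compat|rewrite Rinv_0; lra].
Qed.

(** This is the power [-3/2] of [1 + x]: the exponent 3 is shared equally between the two
    coordinates, and 3/2 > 1 keeps each one-variable sum finite. *)
Definition decay (x : R) : R := (/ ((1 + x) * sqrt (1 + x)))%R.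

Lemma decay_ge0 (x : R) : (0 <= x)%R -> (0 <= decay x)%R.
Proof.
  intros Hx; left; apply Rinv_0_lt_compat, Rmult_lt_0_compat; [lra|].
  apply sqrt_lt_R0; lra.
Qed.

(** Each new term is at most a difference of consecutive values of [2 / sqrt (1 + n)], so the sum
    telescopes as in the integral test. The constant 3 makes the case [K = 0] an equality. *)
Lemma rsum_decay (K : nat) :
  (rsum (fun n => decay (INR n)) (seq 0 (S K)) <= 3 - 2 / sqrt (1 + INR K))%R.
Proof.
  induction K as [|K IH].
  - unfold rsum, decay; simpl; rewrite !Rplus_0_r, sqrt_1; lra.
  - rewrite seq_S, rsum_app; simpl (0 + S K)%nat.
    assert (HK := pos_INR K).
    assert (Hs : (decay (INR (S K)) <=
                  2 / sqrt (1 + INR K) - 2 / sqrt (1 + INR (S K)))%R).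
    { rewrite S_INR; unfold decay.
      set (s := sqrt (1 + INR K)); set (t := sqrt (1 + (INR K + 1))).
      assert (Hs : (s * s = 1 + INR K)%R) by (apply sqrt_sqrt; lra).
      assert (Ht : (t * t = 1 + (INR K + 1))%R) by (apply sqrt_sqrt; lra).
      assert (Hs0 : (0 < s)%R) by (apply sqrt_lt_R0; lra).
      assert (Ht0 : (0 < t)%R) by (apply sqrt_lt_R0; lra).
      assert (Hst : (s < t)%R) by (apply sqrt_lt_1; lra).
      rewrite <- Ht.
      (* Since [t * t - s * s = 1], the difference is [2 / (s t (t + s))], and [s < t] puts it above
         [1 / t^3]. *)
      replace (2 / s - 2 / t)%R with (2 / (s * t * (t + s)))%R.
      - apply Rmult_le_reg_r with (t * t * t * (s * (t + s)))%R;
          [repeat apply Rmult_lt_0_compat; lra|].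
        field_simplify; nra.
      - apply Rmult_eq_reg_r with (s * t * (t + s))%R;
          [|apply Rgt_not_eq; repeat apply Rmult_lt_0_compat; lra].
        field_simplify; nra. }
    replace (rsum _ (S K :: nil)) with (decay (INR (S K)))
      by (unfold rsum; cbn [map fold_right]; ring).
    lra.
Qed.

(* With [m = max |a| |b| >= 1] one has [(1 + |a|) (1 + |b|) <= (2 m)^2], so the
   cube of [m] dominates a product of two summable one-variable weights. *)
Lemma inv_cube_le_decay (c x y N : R) :
  (0 < c)%R -> (0 <= x)%R -> (0 <= y)%R -> (c * x <= N)%R -> (c * y <= N)%R ->
  (1 <= x \/ 1 <= y)%R ->
  (/ N ^ 3 <= 8 / c ^ 3 * (decay x * decay y))%R.
Proof.
  intros Hc Hx Hy HNx HNy H1.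
  assert (Hm : exists m, (1 <= m /\ x <= m /\ y <= m /\ c * m <= N)%R).
  { destruct (Rle_lt_dec x y); [exists y|exists x]; lra. }
  destruct Hm as (m & Hm1 & Hmx & Hmy & HmN).
  unfold decay.
  set (s := sqrt (1 + x)); set (t := sqrt (1 + y)).
  assert (Hs : (s * s = 1 + x)%R) by (apply sqrt_sqrt; lra).
  assert (Ht : (t * t = 1 + y)%R) by (apply sqrt_sqrt; lra).
  assert (Hs0 : (0 < s)%R) by (apply sqrt_lt_R0; lra).
  assert (Ht0 : (0 < t)%R) by (apply sqrt_lt_R0; lra).
  rewrite <- Hs, <- Ht.
  assert (Hst : (s * t <= 2 * m)%R).
  { assert ((s * t) * (s * t) <= (2 * m) * (2 * m))%R; [|nra].
    replace (s * t * (s * t))%R with ((s * s) * (t * t))%R by ring.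
    rewrite Hs, Ht; apply Rmult_le_compat; lra. }
  assert (Hp : (0 < s * t)%R) by now apply Rmult_lt_0_compat.
  replace (8 / c ^ 3 * _)%R with (/ ((c * (s * t / 2)) ^ 3))%R by (field; lra).
  assert (0 < c * (s * t / 2))%R by (apply Rmult_lt_0_compat; lra).
  apply Rinv_le_contravar; [now apply pow_lt|].
  apply pow_incr; nra.
Qed.

(** A finite set of lattice points sits in a box, where the dominating weights form a product. The
    double sum then factors into two one-variable sums, each at most 6: 3 from each sign of the
    coordinate. *)
Lemma lattice_inv_cube_bounded (w1 w2 : C) :
  w2 <> 0 -> (~ exists x : R, w1 / w2 = RtoC x) ->
  exists M, sums_bounded (punctured (lattice w1 w2)) (fun w => / Cmod w ^ 3)%R M.
Proof.
  intros hw2 hw; destruct (lattice_coords_bound w1 w2 hw2 hw) as (c & Hc & H).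
  exists (8 / c ^ 3 * (6 * 6))%R; intros F HF HFD.
  assert (HB : exists B, forall w, In w F -> (Cmod w <= B)%R).
  { clear; induction F as [|v F [B HB]]; [now exists 0%R|].
    exists (Rmax (Cmod v) B); intros w [<-|Hw]; [apply Rmax_l|].
    eapply Rle_trans; [apply HB, Hw|apply Rmax_r]. }
  destruct HB as [B HB].
  destruct (lattice_ball_in_box w1 w2 B hw2 hw) as [K HK].
  assert (Hinv0 : forall x : R, (0 <= x)%R -> (0 <= / x ^ 3)%R).
  { intros x Hx; apply Rinv_ge0, pow_le, Hx. }
  apply Rle_trans with (rsum (fun w => / Cmod w ^ 3)%R (box w1 w2 K)).
  { apply rsum_incl_le; auto using Cmod_ge_0.
    intros w Hw; apply HK; [apply HFD, Hw|auto]. }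
  unfold box; rewrite rsum_map.
  set (r := map Z.of_nat _ ++ _).
  set (u := fun a : Z => decay (Rabs (IZR a))).
  assert (Hc3 : (0 < 8 / c ^ 3)%R).
  { apply Rdiv_lt_0_compat; [lra|now apply pow_lt]. }
  apply Rle_trans with
    (rsum (fun p => 8 / c ^ 3 * (u (fst p) * u (snd p)))%R (list_prod r r)).
  { apply rsum_le; intros [a b] _; simpl fst; simpl snd.
    destruct (H (IZR a) (IZR b)) as [Ha Hb].
    destruct (Z.eq_dec a 0) as [->|Ha0].
    - destruct (Z.eq_dec b 0) as [->|Hb0].
      + (* the point [w = 0] of the box, where [/ 0 = 0] *)
        replace (_ + _) with (RtoC 0) by ring.
        rewrite Cmod_0, pow_i, Rinv_0 by lia.
        apply Rmult_le_pos; [lra|].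
        apply Rmult_le_pos; apply decay_ge0, Rabs_pos.
      + apply inv_cube_le_decay; auto using Rabs_pos, Rabs_IZR_ge1.
    - apply inv_cube_le_decay; auto using Rabs_pos, Rabs_IZR_ge1. }
  rewrite rsum_scal, rsum_list_prod.
  assert (Hr : (0 <= rsum u r <= 6)%R).
  { split; [apply rsum_ge0; intros; apply decay_ge0, Rabs_pos|].
    unfold r; rewrite rsum_app, !rsum_map.
    assert (E : forall v : nat -> Z, (forall n, Rabs (IZR (v n)) = INR n) ->
      (rsum (fun n => u (v n)) (seq 0 (S K)) <= 3)%R).
    { intros v Hv; eapply Rle_trans; [|apply Rle_trans with (1 := rsum_decay K)].
      - apply rsum_le; intros n _; unfold u; rewrite Hv; lra.
      - assert (0 < 2 / sqrt (1 + INR K))%R; [|lra].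
        assert (HK' := pos_INR K).
        apply Rdiv_lt_0_compat; [lra|apply sqrt_lt_R0; lra]. }
    assert (E1 := E Z.of_nat); assert (E2 := E (fun n => (- Z.of_nat n)%Z)).
    cbv beta in *.
    replace 6%R with (3 + 3)%R by ring; apply Rplus_le_compat.
    - apply E1; intros n; rewrite <- INR_IZR_INZ; apply Rabs_pos_eq, pos_INR.
    - apply E2; intros n; rewrite opp_IZR, Rabs_Ropp, <- INR_IZR_INZ.
      apply Rabs_pos_eq, pos_INR. }
  apply Rmult_le_compat_l; [lra|]; apply Rmult_le_compat; lra.
Qed.

(** * The expansion *)

Lemma Cmod_plus_ge (z w : C) (q : R) :
  (Cmod z <= q * Cmod w)%R -> ((1 - q) * Cmod w <= Cmod (z + w))%R.
Proof.
  intros H.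
  assert (H1 := Cmod_triangle (z + w) (- z)).
  replace (z + w + - z) with w in H1 by ring.
  rewrite Cmod_opp in H1; lra.
Qed.

(** Over a common denominator the leading parts cancel: the numerator [- z (2 w + z)] is at most of
    order [Cmod w] against a denominator of order [Cmod w ^ 4], which leaves cubic decay. *)
Lemma weierstrass_term_bound (z w : C) (q : R) :
  w <> 0 -> (0 <= q < 1)%R -> (Cmod z <= q * Cmod w)%R ->
  (Cmod (weierstrass_term z w) <= 3 * Cmod z / (1 - q) ^ 2 * / Cmod w ^ 3)%R.
Proof.
  intros Hw Hq Hz.
  assert (Hw0 := proj1 (Cmod_gt_0 w) Hw); assert (Hz0 := Cmod_ge_0 z).
  assert (Hzw := Cmod_plus_ge z w q Hz).
  assert (Hd : (0 < (1 - q) * Cmod w)%R) by (apply Rmult_lt_0_compat; lra).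
  assert (Hzw0 : z + w <> 0) by (apply Cmod_gt_0; lra).
  replace (weierstrass_term z w) with
    (- (z * (2 * w + z)) / (w ^ 2 * (z + w) ^ 2))
    by (unfold weierstrass_term; field; auto).
  rewrite Cmod_div by (apply Cmult_neq_0; apply Cpow_nz; auto).
  rewrite Cmod_opp, !Cmod_mult, !Cmod_pow.
  assert (Hn : (Cmod (2 * w + z) <= 3 * Cmod w)%R).
  { eapply Rle_trans; [apply Cmod_triangle|].
    rewrite Cmod_mult, Cmod_R, Rabs_pos_eq by lra; nra. }
  replace (3 * Cmod z / (1 - q) ^ 2 * / Cmod w ^ 3)%R with
    (Cmod z * (3 * Cmod w) * / (Cmod w ^ 2 * ((1 - q) * Cmod w) ^ 2))%R
    by (field; lra).
  apply Rmult_le_compat.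
  - apply Rmult_le_pos; auto using Cmod_ge_0.
  - apply Rinv_ge0, Rmult_le_pos; apply pow_le; lra.
  - now apply Rmult_le_compat_l.
  - apply Rinv_le_contravar.
    + apply Rmult_lt_0_compat; now apply pow_lt.
    + apply Rmult_le_compat_l; [apply pow_le; lra|apply pow_incr; lra].
Qed.

(** With [x = (z / w)^2] the left side is [((1 + x) / (1 - x)^2 - 1) / w^2], and
    [(1 + x) / (1 - x)^2] generates the odd numbers [2 n + 1]. The last summand is the closed form
    of the tail, so the identity is algebraic and requires no convergence. *)
Lemma weierstrass_term_symmetrized (z w : C) (N : nat) :
  w <> 0 -> z + w <> 0 -> z + - w <> 0 ->
  1 / 2 * (weierstrass_term z w + weierstrass_term z (- w)) =
  sum_n (fun n => RtoC (INR (2 * S n + 1)) * z ^ (2 * S n) *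
                  (1 / w ^ (2 * S n + 2))) N +
  (z / w) ^ (2 * N + 4) *
    (RtoC (INR (2 * N + 5)) * w ^ 2 - RtoC (INR (2 * N + 3)) * z ^ 2) /
    ((z + w) * (z + - w)) ^ 2.
Proof.
  intros Hw Hp Hm.
  assert (Hm' : z - w <> 0) by exact Hm.
  assert (HR : forall n k : nat, RtoC (INR (2 * n + k)) = 2 * RtoC (INR n) + RtoC (INR k)).
  { intros n k; now rewrite plus_INR, mult_INR, RtoC_plus, RtoC_mult. }
  induction N as [|N IH].
  - rewrite sum_O; unfold weierstrass_term; simpl INR; simpl Cpow.
    rewrite !RtoC_plus; field; repeat split; auto.
  - rewrite IH, sum_Sn; clear IH.
    set (s := sum_n _ N).
    change (plus s) with (Cplus s).
    rewrite !HR, !S_INR, !RtoC_plus; simpl (INR 0).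
    (* All powers are reduced to the exponent [2 * N + 4]. Once these powers and [N] are atoms, the
       induction step is an identity of rational functions. *)
    replace (2 * S N + 4)%nat with ((2 * N + 4) + 2)%nat by lia.
    replace (2 * S (S N))%nat with (2 * N + 4)%nat by lia.
    rewrite !(Cpow_add_r _ (2 * N + 4) 2).
    replace ((z / w) ^ (2 * N + 4)) with (z ^ (2 * N + 4) / w ^ (2 * N + 4)).
    2:{ unfold Cdiv; rewrite Cpow_mult_l, Cpow_inv; auto. }
    assert (HW : w ^ (2 * N + 4) <> 0) by now apply Cpow_nz.
    set (W := w ^ (2 * N + 4)) in *; set (Z := z ^ (2 * N + 4)).
    set (n := RtoC (INR N)).
    simpl INR; rewrite ?RtoC_plus.
    field; repeat split; auto.
Qed.

(** Each of the [N + 1] terms of [1 + q + ... + q^N] is at least [q^N], and this sum times [1 - q]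
    is [1 - q^(N+1)]. The induction needs that sharper right side. *)
Lemma linear_geometric_le (q : R) (N : nat) :
  (0 <= q < 1)%R -> ((INR N + 1) * q ^ N * (1 - q) <= 1)%R.
Proof.
  intros Hq.
  assert (H : ((INR N + 1) * q ^ N * (1 - q) <= 1 - q ^ S N)%R).
  { induction N as [|N IH]; [simpl; lra|].
    rewrite S_INR.
    assert (Hp : (0 <= q ^ S N <= 1)%R).
    { split; [apply pow_le; lra|].
      rewrite <- (pow1 (S N)); apply pow_incr; lra. }
    replace ((INR N + 1 + 1) * q ^ S N * (1 - q))%R with
      (q * ((INR N + 1) * q ^ N * (1 - q)) + q ^ S N * (1 - q))%R
      by (simpl; ring).
    replace (q ^ S (S N))%R with (q * q ^ S N)%R by reflexivity.
    nra. }
  assert (0 <= q ^ S N)%R by (apply pow_le; lra); lra.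
Qed.

Lemma symmetrized_remainder_bound (z w : C) (q : R) (N : nat) :
  w <> 0 -> (0 <= q < 1)%R -> (Cmod z <= q * Cmod w)%R ->
  (Cmod (1 / 2 * (weierstrass_term z w + weierstrass_term z (- w)) -
     sum_n (fun n => RtoC (INR (2 * S n + 1)) * z ^ (2 * S n) *
                     (1 / w ^ (2 * S n + 2)))%C N)
   <= 8 * Cmod z / (1 - q) ^ 5 * q ^ N * / Cmod w ^ 3)%R.
Proof.
  intros Hw Hq Hz.
  assert (Hw0 := proj1 (Cmod_gt_0 w) Hw); assert (Hz0 := Cmod_ge_0 z).
  assert (Hp := Cmod_plus_ge z w q Hz).
  assert (Hm := Cmod_plus_ge z (- w) q); rewrite Cmod_opp in Hm.
  specialize (Hm Hz).
  assert (Hd : (0 < (1 - q) * Cmod w)%R) by (apply Rmult_lt_0_compat; lra).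
  assert (Hp0 : z + w <> 0) by (apply Cmod_gt_0; lra).
  assert (Hm0 : z + - w <> 0) by (apply Cmod_gt_0; lra).
  rewrite (weierstrass_term_symmetrized z w N Hw Hp0 Hm0).
  set (s := sum_n _ N).
  match goal with |- (Cmod (s + ?r - s) <= _)%R =>
    replace (s + r - s) with r by ring end.
  clear s.
  rewrite Cmod_div by (apply Cpow_nz, Cmult_neq_0; auto).
  rewrite Cmod_mult, !Cmod_pow, Cmod_mult, Cmod_div by easy.
  set (u := (Cmod z / Cmod w)%R).
  assert (Hu : (0 <= u <= q)%R).
  { unfold u; split; [now apply Rdiv_le_0_compat|].
    apply Rmult_le_reg_r with (Cmod w); auto; field_simplify; lra. }
  assert (HN := pos_INR N).
  (* Since [Cmod z <= Cmod w], the coefficients add up to [4 N + 8], at most [8 (N + 1)]. *)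
  assert (Hnum : (Cmod (RtoC (INR (2 * N + 5)) * w ^ 2 -
      RtoC (INR (2 * N + 3)) * z ^ 2) <= 8 * (INR N + 1) * Cmod w ^ 2)%R).
  { eapply Rle_trans; [apply Cmod_triangle|].
    rewrite Cmod_opp, !Cmod_mult, !Cmod_pow, !Cmod_R.
    rewrite !Rabs_pos_eq, !plus_INR, !mult_INR by apply pos_INR; simpl INR.
    assert (Cmod z ^ 2 <= Cmod w ^ 2)%R by (apply pow_incr; nra).
    assert (0 <= Cmod z ^ 2)%R by now apply pow_le.
    nra. }
  (* One factor [q ^ N] is kept as the geometric rate and the other will absorb [N + 1]. The single
     [u] supplies [Cmod z] and the third inverse power of [Cmod w]. *)
  assert (Hu4 : (u ^ (2 * N + 4) <= q ^ N * q ^ N * u)%R).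
  { replace (2 * N + 4)%nat with (N + N + 1 + 3)%nat by lia.
    rewrite !pow_add, pow_1.
    assert (u ^ N <= q ^ N)%R by now apply pow_incr.
    assert (0 <= u ^ N)%R by now apply pow_le.
    assert (u ^ 3 <= 1)%R by (rewrite <- (pow1 3); apply pow_incr; lra).
    assert (0 <= u ^ 3)%R by now apply pow_le.
    assert (u ^ N * u ^ N <= q ^ N * q ^ N)%R by (apply Rmult_le_compat; auto).
    assert (0 <= u ^ N * u ^ N)%R by now apply Rmult_le_pos.
    rewrite <- (Rmult_1_r (q ^ N * q ^ N * u)).
    apply Rmult_le_compat; auto; [apply Rmult_le_pos; lra|].
    apply Rmult_le_compat; lra. }
  assert (Hden : (((1 - q) * Cmod w * ((1 - q) * Cmod w)) ^ 2 <=
                  (Cmod (z + w) * Cmod (z + - w)) ^ 2)%R).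
  { apply pow_incr; split; [apply Rmult_le_pos; lra|].
    apply Rmult_le_compat; lra. }
  assert (Hden0 : (0 < ((1 - q) * Cmod w * ((1 - q) * Cmod w)) ^ 2)%R).
  { apply pow_lt; now apply Rmult_lt_0_compat. }
  assert (Hqn : (0 <= q ^ N)%R) by now apply pow_le.
  apply Rle_trans with ((q ^ N * q ^ N * u) * (8 * (INR N + 1) * Cmod w ^ 2) /
    (((1 - q) * Cmod w * ((1 - q) * Cmod w)) ^ 2))%R.
  - apply Rmult_le_compat.
    + apply Rmult_le_pos; [now apply pow_le|apply Cmod_ge_0].
    + apply Rinv_ge0; lra.
    + apply Rmult_le_compat; auto using Cmod_ge_0; now apply pow_le.
    + now apply Rinv_le_contravar.
  (* Four of the five powers of [1 - q] come from the denominator; the fifth is spent on the linear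
     factor [N + 1]. *)
  - set (b := (8 * Cmod z / (1 - q) ^ 5 * q ^ N * / Cmod w ^ 3)%R).
    replace (_ / _)%R with (b * ((INR N + 1) * q ^ N * (1 - q)))%R
      by (unfold b, u; field; lra).
    rewrite <- (Rmult_1_r b) at 2.
    apply Rmult_le_compat_l; [|now apply linear_geometric_le].
    apply Rmult_le_pos; [apply Rmult_le_pos; auto|].
    + apply Rdiv_le_0_compat; [lra|apply pow_lt; lra].
    + apply Rinv_ge0, pow_le; lra.
Qed.

Lemma is_series_of_geometric_bound (a : nat -> C) (s : C) (c q : R) :
  (0 <= q < 1)%R ->
  (forall N, (Cmod (s - sum_n a N) <= c * q ^ N)%R) -> is_series a s.
Proof.
  intros Hq H; unfold is_series.
  apply (@filterlim_locally _ C_UniformSpace _ _); intros eps.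
  assert (Hc : is_lim_seq (fun N => c * q ^ N)%R 0%R).
  { replace (Finite 0) with (Rbar_mult c 0) by (simpl; f_equal; ring).
    apply is_lim_seq_scal_l, is_lim_seq_geom; rewrite Rabs_pos_eq; lra. }
  apply is_lim_seq_spec in Hc; destruct (Hc eps) as [N0 HN0].
  exists N0; intros N HN; apply C_NormedModule_mixin_compat1.
  change (Cmod (sum_n a N - s) < eps)%R.
  replace (sum_n a N - s) with (- (s - sum_n a N)) by ring; rewrite Cmod_opp.
  eapply Rle_lt_trans; [apply H|].
  specialize (HN0 N HN); rewrite Rminus_0_r in HN0.
  eapply Rle_lt_trans; [apply Rle_abs|exact HN0].
Qed.

Lemma punctured_lattice_opp (w1 w2 w : C) :
  punctured (lattice w1 w2) w -> punctured (lattice w1 w2) (- w).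
Proof.
  intros [(a & b & ->) H]; split.
  - exists (- a)%Z, (- b)%Z; rewrite !opp_IZR, !RtoC_opp; ring.
  - intros E; apply H; replace (_ + _) with
      (- - (RtoC (IZR a) * w1 + RtoC (IZR b) * w2)) by ring.
    rewrite E; ring.
Qed.

(** Three powers of [1 / w] give summability; the remaining [n] are bounded by [/ r ^ n], as lattice
    points stay at distance [r] from 0. *)
Lemma ex_sum_lattice_inv_pow (w1 w2 : C) (n : nat) :
  w2 <> 0 -> (~ exists x : R, w1 / w2 = RtoC x) ->
  ex_sum (punctured (lattice w1 w2)) (fun w => 1 / w ^ (n + 3)).
Proof.
  intros hw2 hw.
  destruct (lattice_Cmod_ge w1 w2 hw2 hw) as (r & Hr & Hrw).
  destruct (lattice_inv_cube_bounded w1 w2 hw2 hw) as (M & HM).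
  apply ex_sum_dominated with (fun w => / Cmod w ^ 3)%R (/ r ^ n)%R M; auto.
  - apply Rinv_ge0, pow_le; lra.
  - intros w Hw; assert (H := Hrw w Hw).
    rewrite Cmod_div by apply Cpow_nz, Hw.
    rewrite Cmod_1, Cmod_pow, pow_add.
    unfold Rdiv; rewrite Rmult_1_l, Rinv_mult.
    apply Rmult_le_compat_r; [apply Rinv_ge0, pow_le; lra|].
    apply Rinv_le_contravar; [now apply pow_lt|apply pow_incr; lra].
Qed.

Theorem theorem4p1 (w1 w2 : C) (hw1 : w1 <> 0) (hw2 : w2 <> 0)
    (hw : ~ exists x : R, w1 / w2 = RtoC x) :
  let L := lattice w1 w2 in
  (forall k : nat, (1 <= k)%nat ->
     ex_sum (punctured L) (fun w => 1 / w ^ (2 * k + 2))) /\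
  (exists r : R, (0 < r)%R /\ forall w, punctured L w -> (r <= Cmod w)%R) /\
  (forall z : C, z <> 0 ->
     (forall w, punctured L w -> (Cmod z < Cmod w)%R) ->
     ex_sum (punctured L) (weierstrass_term z) /\
     exists s : C,
       is_series (fun n : nat => let k := S n in
         RtoC (INR (2 * k + 1)) * eisenstein L (2 * k + 2) * z ^ (2 * k)) s /\
       weierstrass_p L z = 1 / z ^ 2 + s).
Proof.
  intros L.
  assert (HE : forall k : nat, (1 <= k)%nat ->
     ex_sum (punctured L) (fun w => 1 / w ^ (2 * k + 2))).
  (* The subtraction of natural numbers is exact because [1 <= k]. *)
  { intros k Hk; replace (2 * k + 2)%nat with (2 * k - 1 + 3)%nat by lia.
    now apply ex_sum_lattice_inv_pow. }
  split; [exact HE|split; [now apply lattice_Cmod_ge|]].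
  intros z _ Hz.
  destruct (lattice_inv_cube_bounded w1 w2 hw2 hw) as (M & HM).
  destruct (lattice_ratio_lt_1 w1 w2 z hw2 hw Hz) as (q & Hq & Hzq).
  assert (Hex : ex_sum (punctured L) (weierstrass_term z)).
  { eapply ex_sum_dominated; [|exact HM|].
    2:{ intros w Hw; apply weierstrass_term_bound; [apply Hw|exact Hq|auto]. }
    apply Rdiv_le_0_compat; [|apply pow_lt; lra].
    assert (H := Cmod_ge_0 z); lra. }
  split; [exact Hex|].
  set (s := Csum (punctured L) (weierstrass_term z)).
  exists s; split; [|reflexivity].
  (* Reindexing by negation fixes the value [s], so averaging the two summands leaves the sum
     unchanged. *)
  assert (Hs : is_sum (punctured L)
    (fun w => 1 / 2 * (weierstrass_term z w + weierstrass_term z (- w))) s).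
  { replace s with (1 / 2 * (s + s)) by field.
    apply is_sum_scal, is_sum_plus.
    - now apply Csum_correct.
    - apply is_sum_opp_arg; [apply punctured_lattice_opp|].
      now apply Csum_correct. }
  apply is_series_of_geometric_bound with
    (8 * Cmod z / (1 - q) ^ 5 * M)%R q; [exact Hq|]; intros N.
  replace (8 * Cmod z / (1 - q) ^ 5 * M * q ^ N)%R with
    (8 * Cmod z / (1 - q) ^ 5 * q ^ N * M)%R by ring.
  (* The error after [N] is a single lattice sum of the symmetrized remainders, because a finite sum
     over [n] commutes with the lattice sum. The termwise bound thus passes to the error. *)
  apply (Cmod_is_sum_le (punctured L)
    (fun w => 1 / 2 * (weierstrass_term z w + weierstrass_term z (- w)) +
     -1 * sum_n (fun n => RtoC (INR (2 * S n + 1)) * z ^ (2 * S n) *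
                          (1 / w ^ (2 * S n + 2))) N)
    _ (fun w => / Cmod w ^ 3)%R).
  - assert (H := Cmod_ge_0 z).
    apply Rmult_le_pos; [|apply pow_le; lra].
    apply Rdiv_le_0_compat; [lra|apply pow_lt; lra].
  - exact HM.
  - intros w Hw.
    match goal with |- (Cmod (?a + _ * ?b) <= _)%R =>
      replace (a + -1 * b) with (a - b) by ring end.
    apply symmetrized_remainder_bound; [apply Hw|exact Hq|auto].
  - match goal with |- is_sum _ _ (s - ?b) =>
      replace (s - b) with (s + -1 * b) by ring end.
    apply is_sum_plus; [exact Hs|apply is_sum_scal].
    apply is_sum_sum_n with
      (f := fun n w => RtoC (INR (2 * S n + 1)) * z ^ (2 * S n) *
                       (1 / w ^ (2 * S n + 2))).
    intros n; cbv zeta.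
    replace (_ * eisenstein _ _ * _) with
      (RtoC (INR (2 * S n + 1)) * z ^ (2 * S n) * eisenstein L (2 * S n + 2))
      by ring.
    apply is_sum_scal, Csum_correct, HE; lia.
Qed.
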